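(* Let $(\chi_n)_{n\ge 1}$ be as in the context, let $f:[0,\infty)\to[0,\infty)$ satisfy $f(0)=0$ and $f(x)>0$ for $x>0$, and suppose there is a point $b_1>0$ such that $f(x)<x$ and $f(x)\le f(b_1)$ for all $x\in(0,b_1)$, and such that $f(b_1)<b_1$. Let $l>0$ satisfy $l\le b_1-f(b_1)$, let $x_0\in[0,b_1]$, and let $(x_n)$ be the solution of $$x_{n+1}=\max\{f(x_n)+l\chi_{n+1},\,0\},\qquad n=0,1,2,\dots$$ with initial value $x_0$. Then, almost surely, $x_n\in[0,b_1]$ for all $n\in\mathbb N$.
   Context: $(\chi_n)_{n\ge1}$ is a sequence of independent identically distributed continuous real random variables with zero mean on a complete probability space, whose common density $\phi$ satisfies $\phi(x)>0$ for $x\in(-1,1)$ and $\phi(x)=0$ for $x\notin[-1,1]$. The initial value $x_0$ is deterministic. *)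

(* Defs.v *)
From HB Require Import structures.
From mathcomp Require Export all_boot all_order all_algebra.
From mathcomp Require Export all_classical all_reals all_analysis.

Set Implicit Arguments.
Unset Strict Implicit.
Unset Printing Implicit Defensive.

Import Order.TTheory GRing.Theory Num.Theory.
Import numFieldNormedType.Exports.

Local Open Scope classical_set_scope.
Local Open Scope ring_scope.

(* Mutual independence of the family (X_i), i in D; D = {1, 2, ...} serves for
   sequences that start at index 1. *)
Definition independent_RVs (d : measure_display) (T : measurableType d)
    (R : realType) (P : probability T R) (I : choiceType) (D : set I)
    (X : I -> {RV P >-> R}) : Prop :=
  forall (s : seq I) (A : I -> set R),
    uniq s -> [set` s] `<=` D ->
    (forall i, i \in s -> measurable (A i)) ->
    P (\bigcap_(i in [set` s]) (X i @^-1` A i)) =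
    (\prod_(i <- s) P (X i @^-1` A i))%E.

Definition identically_distributed (d : measure_display) (T : measurableType d)
    (R : realType) (P : probability T R) (I : Type) (D : set I)
    (X : I -> {RV P >-> R}) : Prop :=
  forall i j, D i -> D j -> forall A : set R, measurable A ->
    distribution P (X i) A = distribution P (X j) A.

(* "Continuous random variable" is read as: the law is absolutely continuous.
   The density itself need not be continuous. *)
Definition has_density (d : measure_display) (T : measurableType d)
    (R : realType) (P : probability T R) (X : {RV P >-> R})
    (phi : R -> R) : Prop :=
  [/\ measurable_fun [set: R] phi,
      forall u, 0 <= phi u &
      forall A : set R, measurable A ->
        distribution P X A =
        (\int[lebesgue_measure]_(u in A) (phi u)%:E)%E].

(* [x] solves x_{n+1} = max (f x_n + l chi_{n+1}) 0 path by path, from the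
   deterministic initial value [x0].  No measurability of [f] is assumed, so the
   [x n] are plain functions on the sample space.  The value [chi 0] is unused. *)
Definition truncated_solution (T : Type) (R : realType) (f : R -> R) (l : R)
    (chi : nat -> T -> R) (x0 : R) (x : nat -> T -> R) : Prop :=
  (forall w, x 0%N w = x0) /\
  (forall n w, x n.+1 w = Num.max (f (x n w) + l * chi n.+1 w) 0).

(* Main.v *)
Require Import Defs.
Import Order.TTheory GRing.Theory Num.Theory.
Import numFieldNormedType.Exports.
Local Open Scope classical_set_scope.
Local Open Scope ring_scope.

(** The interval [[0, b1]] is invariant as long as the noise stays at most 1: there [f] is bounded
    by [f b1], so a step reaches at most [f b1 + l <= b1], while truncation keeps it nonnegative. By
    [has_density_support] each [chi n.+1] lies in [[-1, 1]] almost surely; discarding countably many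
    null events gives this for all [n] at once, and the rest is a pathwise induction. *)

Lemma has_density_support (d : measure_display) (T : measurableType d)
    (R : realType) (P : probability T R) (X : {RV P >-> R}) (phi : R -> R)
    (A : set R) :
  has_density X phi -> measurable A -> (forall u, ~ A u -> phi u = 0) ->
  {ae P, forall w, A (X w)}.
Proof.
(* The exceptional event is the preimage of the complement of [A]; its probability is the integral
   of [phi] over a set where [phi] vanishes. *)
move=> [_ _ lawX] mA phi0; exists (X @^-1` ~` A); split.
- by apply: measurable_funPTI; exact: measurableC.
- rewrite -[LHS]/(distribution P X (~` A)) lawX; last exact: measurableC.
  by apply: integral0_eq => u /phi0 ->.
- by [].
Qed.

Theorem lemma3p1 (d : measure_display) (T : measurableType d) (R : realType)
    (P : probability T R) (P_complete : measure_is_complete P)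
    (chi : nat -> {RV P >-> R}) (phi : R -> R)
    (chi_indep : independent_RVs [set n | (1 <= n)%N] chi)
    (chi_id : identically_distributed [set n | (1 <= n)%N] chi)
    (chi_mean : forall n, (1 <= n)%N -> ('E_P[chi n] = 0)%E)
    (chi_density : forall n, (1 <= n)%N -> has_density (chi n) phi)
    (phi_pos : forall u, u \in `]-1, 1[ -> 0 < phi u)
    (phi_out : forall u, u \notin `[-1, 1] -> phi u = 0)
    (f : R -> R)
    (f_ge0 : forall u, 0 <= u -> 0 <= f u)
    (f0 : f 0 = 0)
    (f_pos : forall u, 0 < u -> 0 < f u)
    (b1 : R) (b1_pos : 0 < b1)
    (f_b1 : forall u, u \in `]0, b1[ -> f u < u /\ f u <= f b1)
    (fb1_lt : f b1 < b1)
    (l : R) (l_pos : 0 < l) (l_le : l <= b1 - f b1)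
    (x0 : R) (x0_in : x0 \in `[0, b1])
    (x : nat -> T -> R)
    (x_sol : truncated_solution f l (fun n => chi n : T -> R) x0 x) :
  {ae P, forall w, forall n : nat, x n w \in `[0, b1]}.
Proof.
(* [f_b1] covers only the open interval; at the endpoint 0 the bound comes from
   [f 0 = 0 <= f b1]. *)
have f_le u : u \in `[0, b1] -> f u <= f b1.
  rewrite in_itv /= => /andP[].
  rewrite le_eqVlt => /predU1P[<- _|u0]; first by rewrite f0 f_ge0// ltW.
  rewrite le_eqVlt => /predU1P[->//|ub].
  by apply: (f_b1 u _).2; rewrite in_itv /= u0.
have chi_in n : {ae P, forall w, chi n.+1 w \in `[-1, 1]}.
  apply: (has_density_support _ _ _ _ _ _ [set` `[-1, 1]]
                              (chi_density n.+1 isT)).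
    exact: measurable_itv.
  by move=> u /negP/phi_out.
case: x_sol => x_init x_step.
(* A countable union of null sets is null, so one path [w] with all its noise values in [[-1, 1]]
   can be fixed. *)
apply: filterS (ae_foralln chi_in) => w chi_w.
elim=> [|n /f_le fx]; first by rewrite x_init.
(* The lower bound is the truncation at 0; what remains is [f (x n w) + l * chi n.+1 w <= f b1 + (b1
   - f b1)]. *)
rewrite x_step in_itv /= le_max lexx orbT ge_max (ltW b1_pos) andbT.
have := chi_w n; rewrite in_itv /= => /andP[_ chi1].
have : l * chi n.+1 w <= l by rewrite ger_pMr.
by move=> /le_trans /(_ l_le) /(lerD fx); rewrite subrKC.
Qed.
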